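(* Let $M$ be a matroid and $t\in\mathbb{N}$. If $\tau(M)<\infty$, then $\tau(M^t)=t(\tau(M)-1)+1$.
   Context: A cyclic flat of a matroid $M$ is a flat $F$ such that $M|F$ has no coloops; $\mathcal{Z}(M)$ denotes the set of cyclic flats, and a matroid is determined by its cyclic flats and their ranks. The $t$-expansion: fix $t\in\mathbb{N}$; for each $e\in E(M)$ let $S_e$ be a $t$-element set with $e\in S_e$, the sets $S_e$ pairwise disjoint; for $X\subseteq E(M)$ let $S_X=\bigcup_{e\in X}S_e$. The $t$-expansion $M^t$ is the matroid on $S_{E(M)}$ whose cyclic flats are exactly the sets $S_A$ with $A\in\mathcal{Z}(M)$, with $r_{M^t}(S_A)=t\cdot r_M(A)$. For $X\subseteq E(M)$ let $\overline{X}=E(M)-X$ and $\lambda_M(X)=r(X)+r(\overline{X})-r(M)$. A $k$-separation ($k\in\mathbb{N}$) is a pair $(X,\overline{X})$ with $|X|,|\overline{X}|\geq k$ and $\lambda_M(X)<k$; the Tutte connectivity $\tau(M)$ is the least $k$ for which $M$ has a $k$-separation, and $\tau(M)=\infty$ if there is none. *)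

(* Defs.v *)
From mathcomp Require Import all_boot.

Set Implicit Arguments.
Unset Strict Implicit.
Unset Printing Implicit Defensive.

(* The finite type T is an ambient universe; the ground set is a subset of it,
   so that M, its restrictions and its expansions can share their elements. *)
Record matroid (T : finType) := Matroid {
  ground : {set T};
  indep : pred {set T};
  indep_ground : forall I, indep I -> I \subset ground;
  indep0 : indep set0;
  indepS : forall I J : {set T}, J \subset I -> indep I -> indep J;
  indep_aug : forall I J, indep I -> indep J -> #|I| < #|J| ->
    exists2 e, e \in J :\: I & indep (e |: I)
}.

Section Matroids.
Variable T : finType.
Implicit Types (M N : matroid T) (X Y F I J A B C : {set T}) (e x : T).

Definition rank M X : nat :=
  \max_(I : {set T} | (I \subset X) && indep M I) #|I|.

Definition basis M B : bool := maxset (indep M) B.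

Definition coloop M e : bool :=
  (e \in ground M) && [forall B : {set T}, basis M B ==> (e \in B)].

Definition flat M F : bool :=
  (F \subset ground M) &&
  [forall e in ground M :\: F, rank M F < rank M (e |: F)].

Definition restr_indep M X : pred {set T} :=
  fun I => (I \subset X) && indep M I.

Lemma restr_indep_ground M X I :
  restr_indep M X I -> I \subset ground M :&: X.
Proof. by case/andP=> sIX /indep_ground sIM; rewrite subsetI sIM. Qed.

Lemma restr_indep0 M X : restr_indep M X set0.
Proof. by rewrite /restr_indep sub0set indep0. Qed.

Lemma restr_indepS M X I J :
  J \subset I -> restr_indep M X I -> restr_indep M X J.
Proof.
move=> sJI /andP[sIX iI].
by rewrite /restr_indep (subset_trans sJI) // (indepS sJI).
Qed.

Lemma restr_indep_aug M X I J :
  restr_indep M X I -> restr_indep M X J -> #|I| < #|J| ->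
  exists2 e, e \in J :\: I & restr_indep M X (e |: I).
Proof.
move=> /andP[sIX iI] /andP[sJX iJ] ltIJ.
have [e eJI ieI] := indep_aug iI iJ ltIJ; exists e => //.
rewrite /restr_indep ieI andbT subUset sub1set sIX andbT.
by apply: (subsetP sJX); case/setDP: eJI.
Qed.

Definition restrict M X : matroid T :=
  Matroid (@restr_indep_ground M X) (restr_indep0 M X)
    (@restr_indepS M X) (@restr_indep_aug M X).

Definition cyclic_flats M : {set {set T}} :=
  [set F : {set T} | flat M F & [forall e, ~~ coloop (restrict M F) e]].

(* The subtraction does not truncate: see [rank_ground_le]. *)
Definition lambda M X : nat :=
  rank M X + rank M (ground M :\: X) - rank M (ground M).

Definition separation M (k : nat) X : bool :=
  [&& X \subset ground M, k <= #|X|, k <= #|ground M :\: X| & lambda M X < k].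

Definition has_separation M (k : nat) : bool :=
  [exists X, separation M k X].

Lemma some_separationP M :
  reflect (exists k, has_separation M k)
          [exists k : 'I_#|T|.+1, has_separation M k].
Proof.
apply: (iffP existsP) => [[k sepk] | [k sepk]]; first by exists k.
have ltkT : k < #|T|.+1.
  by case/existsP: sepk => X /and4P[_ leX _ _]; exact: leq_trans leX (max_card _).
by exists (Ordinal ltkT).
Qed.

(* [None] stands for infinity. No 0-separation exists, so a finite value is
   positive. *)
Definition tutte_connectivity M : option nat :=
  match some_separationP M with
  | ReflectT ex_k => Some (ex_minn ex_k)
  | ReflectF _ => None
  end.

Definition blowup (S : T -> {set T}) X : {set T} := \bigcup_(e in X) S e.

(* As e \in S e, this forces 0 < t unless the ground set is empty. *)
Definition expansion_family M (t : nat) (S : T -> {set T}) : Prop :=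
  [/\ {in ground M, forall e, e \in S e},
      {in ground M, forall e, #|S e| = t}
    & {in ground M &, forall e x, e != x -> [disjoint S e & S x]}].

Definition is_expansion M (t : nat) (S : T -> {set T}) N : Prop :=
  [/\ ground N = blowup S (ground M),
      cyclic_flats N = [set blowup S A | A in cyclic_flats M]
    & {in cyclic_flats M, forall A, rank N (blowup S A) = t * rank M A}].

Lemma rank_ge M X I : I \subset X -> indep M I -> #|I| <= rank M X.
Proof.
by move=> sIX iI; apply: (@leq_bigmax_cond _ _ (fun I => #|I|)); rewrite sIX.
Qed.

Lemma rank_ex M X : exists I, [/\ I \subset X, indep M I & #|I| = rank M X].
Proof.
have P0 : 0 < #|[pred I : {set T} | (I \subset X) && indep M I]|.
  by apply/card_gt0P; exists set0; rewrite inE sub0set indep0.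
have [I /andP[sIX iI] rI] := eq_bigmax_cond (fun I : {set T} => #|I|) P0.
by exists I.
Qed.

Lemma rank_ground_le M X :
  rank M (ground M) <= rank M X + rank M (ground M :\: X).
Proof.
have [I [sIM iI <-]] := rank_ex M (ground M).
rewrite -(cardsID X I) leq_add ?rank_ge ?subsetIr ?setSD //.
  exact: indepS (subsetIl _ _) iI.
exact: indepS (subsetDl _ _) iI.
Qed.

Lemma rank_le_card M X : rank M X <= #|X|.
Proof. by have [I [sIX _ <-]] := rank_ex M X; exact: subset_leq_card. Qed.

Lemma rank_indep M I : indep M I -> rank M I = #|I|.
Proof. by move=> iI; apply/eqP; rewrite eqn_leq rank_le_card rank_ge. Qed.

Lemma rankS M X Y : X \subset Y -> rank M X <= rank M Y.
Proof.
move=> sXY; have [I [sIX iI <-]] := rank_ex M X.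
exact: rank_ge (subset_trans sIX sXY) iI.
Qed.

Lemma indep_extend M X I : I \subset X -> indep M I ->
  exists B, [/\ I \subset B, B \subset X, indep M B & #|B| = rank M X].
Proof.
move=> sIX iI; have PI : restr_indep M X I by rewrite /restr_indep sIX.
have [B maxB sIB] := maxset_exists PI.
have /andP[sBX iB] := maxsetp maxB; exists B; split=> //.
apply/eqP; rewrite eqn_leq rank_ge //= leqNgt; apply/negP => ltB.
have [J [sJX iJ cJ]] := rank_ex M X; rewrite -cJ in ltB.
have [e /setDP[eJ neB] ieB] := indep_aug iB iJ ltB.
have PeB : restr_indep M X (e |: B).
  by rewrite /restr_indep ieB subUset sub1set sBX (subsetP sJX).
by move: neB; rewrite -(maxsetsup maxB PeB (subsetUr _ _)) setU11.
Qed.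

Lemma rank_submod M X Y :
  rank M (X :|: Y) + rank M (X :&: Y) <= rank M X + rank M Y.
Proof.
have [I [sI iI <-]] := rank_ex M (X :&: Y).
have sIU : I \subset X :|: Y.
  by apply: subset_trans sI _; apply: subset_trans (subsetIl _ _) (subsetUl _ _).
have [J [sIJ sJ iJ <-]] := indep_extend sIU iI.
have leX : #|J :&: X| <= rank M X.
  by rewrite rank_ge ?subsetIr //; exact: indepS (subsetIl _ _) iJ.
have leY : #|J :&: Y| <= rank M Y.
  by rewrite rank_ge ?subsetIr //; exact: indepS (subsetIl _ _) iJ.
apply: leq_trans (leq_add leX leY); rewrite -(cardsUI (J :&: X)) -setIUr (setIidPl sJ).
rewrite leq_add2l subset_leq_card // setIACA setIid subsetI sIJ //.
Qed.

Lemma coloop_restrict M F e : F \subset ground M ->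
  coloop (restrict M F) e = (e \in F) && (rank M (F :\ e) < rank M F).
Proof.
move=> sFM; rewrite /coloop /= (setIidPr sFM); case: (boolP (e \in F)) => //= eF.
apply/forallP/idP => [bas | ltr B].
  rewrite ltnNge; apply/negP => ler.
  have [I [sI iI cI]] := rank_ex M (F :\ e).
  have sIF := subset_trans sI (subD1set _ _).
  have basI : basis (restrict M F) I.
    apply/maxsetP; split=> [|J /andP[sJF iJ] sIJ]; first by rewrite /= /restr_indep sIF.
    apply/eqP; rewrite eq_sym eqEcard sIJ cI (leq_trans _ ler) //.
    exact: rank_ge.
  have := subsetP sI e (implyP (bas I) basI).
  by rewrite !inE eqxx.
apply/implyP => basB; have /andP[sBF iB] := maxsetp basB.
apply: contraLR ltr => neB; rewrite -leqNgt.
have [C [sBC sCF iC <-]] := indep_extend sBF iB.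
have PC : restr_indep M F C by rewrite /restr_indep sCF.
rewrite (maxsetsup basB PC sBC) rank_ge // subsetD1 sBF; exact: neB.
Qed.

Lemma cyclic_flatP M F :
  reflect [/\ F \subset ground M,
              forall e, e \in ground M -> e \notin F -> rank M F < rank M (e |: F)
            & forall e, e \in F -> rank M F <= rank M (F :\ e)]
          (F \in cyclic_flats M).
Proof.
rewrite inE; apply: (iffP andP) => [[/andP[sF /forall_inP fl] /forallP nc] | [sF fl nc]].
  split=> // e eF => [neF|]; first by apply: fl; rewrite inE neF.
  by have := nc e; rewrite coloop_restrict // eF -leqNgt.
split; last first.
  apply/forallP => e; rewrite coloop_restrict //.
  by apply/negP => /andP[/nc]; rewrite ltnNge => ->.
by rewrite /flat sF; apply/forall_inP => e /setDP[eM neF]; exact: fl.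
Qed.

Section Expansion.
Variables (M : matroid T) (t : nat) (S : T -> {set T}).
Hypothesis hS : expansion_family M t S.
Let E := ground M.

Let Sid x : x \in E -> x \in S x.
Proof. by case: hS => h _ _; exact: h. Qed.

Let Sdisj x y e : x \in E -> y \in E -> e \in S x -> e \in S y -> x = y.
Proof.
case: hS => _ _ h xE yE ex ey; apply/eqP/contraT => /(h _ _ xE yE).
by rewrite disjoint_sym => /disjointFr /(_ ey); rewrite ex.
Qed.

Definition trace Y : {set T} := [set x in E | ~~ [disjoint S x & Y]].

Lemma traceP Y x : reflect (x \in E /\ exists2 e, e \in S x & e \in Y) (x \in trace Y).
Proof.
rewrite inE; apply: (iffP andP) => [[xE /pred0Pn[e /andP[/= e1 e2]]] | [xE [e e1 e2]]].
  by split=> //; exists e.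
by split=> //; apply/pred0Pn; exists e; rewrite /= e1.
Qed.

Lemma blowupP X e : reflect (exists2 x, x \in X & e \in S x) (e \in blowup S X).
Proof. exact: bigcupP. Qed.

Lemma blowupS X Y : X \subset Y -> blowup S X \subset blowup S Y.
Proof.
move=> sXY; apply/subsetP => e /blowupP[x xX ex].
by apply/blowupP; exists x; rewrite ?(subsetP sXY).
Qed.

Lemma traceS X Y : X \subset Y -> trace X \subset trace Y.
Proof.
move=> sXY; apply/subsetP => x /traceP[xE [e e1 e2]].
by apply/traceP; split=> //; exists e; rewrite ?(subsetP sXY).
Qed.

Lemma traceE Y : trace Y \subset E.
Proof. by apply/subsetP => x /traceP[]. Qed.

Lemma traceU X Y : trace (X :|: Y) = trace X :|: trace Y.
Proof.
apply/eqP; rewrite eqEsubset subUset !traceS ?subsetUl ?subsetUr ?andbT //.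
apply/subsetP => x /traceP[xE [e e1 /setUP[] e2]]; apply/setUP; [left|right];
by apply/traceP; split=> //; exists e.
Qed.

Lemma trace_sub X Y : X \subset E -> Y \subset blowup S X -> trace Y \subset X.
Proof.
move=> sXE sY; apply/subsetP => x /traceP[xE [e e1 /(subsetP sY) /blowupP[y yX ey]]].
by rewrite (Sdisj xE (subsetP sXE y yX) e1 ey).
Qed.

Lemma sub_blowup_trace Y : Y \subset blowup S E -> Y \subset blowup S (trace Y).
Proof.
move=> sY; apply/subsetP => e eY; have /blowupP[x xE ex] := subsetP sY e eY.
by apply/blowupP; exists x => //; apply/traceP; split=> //; exists e.
Qed.

Lemma card_trace Y : Y \subset blowup S E -> #|Y| <= t * #|trace Y|.
Proof.
move=> sY; apply: leq_trans (subset_leq_card (sub_blowup_trace sY)) _.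
rewrite mulnC -sum_nat_const /blowup.
apply: (leq_trans (n := \sum_(x in trace Y) #|S x|)); last first.
  by apply: leq_sum => x /(subsetP (traceE Y)) xE; case: hS => _ -> .
elim/big_rec2: _ => [|x n A _ le]; first by rewrite cards0.
by apply: leq_trans (leq_card_setU _ _) _; rewrite leq_add2l.
Qed.

Let f Y := t * rank M (trace Y).

Let fS X Y : X \subset Y -> f X <= f Y.
Proof. by move=> sXY; rewrite leq_mul2l rankS ?orbT // traceS. Qed.

Let fUI X Y : f (X :|: Y) + f (X :&: Y) <= f X + f Y.
Proof.
rewrite /f -!mulnDr leq_mul2l traceU; apply/orP; right.
apply: leq_trans (rank_submod M _ _); rewrite leq_add2l rankS // subsetI.
by rewrite !traceS ?subsetIl ?subsetIr.
Qed.

Let f0 : f set0 = 0.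
Proof.
have tr0 : trace set0 = set0.
  by apply/eqP; rewrite -subset0; apply/subsetP => x /traceP[_ [e _]]; rewrite inE.
have r0 : rank M set0 = 0 by apply/eqP; rewrite -leqn0; have := rank_le_card M set0; rewrite cards0.
by rewrite /f tr0 r0 muln0.
Qed.

(* The matroid induced by the polymatroid Y |-> t * r(trace Y). It witnesses
   that every family S admits an expansion in the sense of [is_expansion]. *)
Definition exp_indep : pred {set T} :=
  fun X => (X \subset blowup S E) &&
    [forall Y : {set T}, (Y \subset X) ==> (#|Y| <= t * rank M (trace Y))].

Let eiP X Y : exp_indep X -> Y \subset X -> #|Y| <= f Y.
Proof. by case/andP=> _ /forallP/(_ Y)/implyP; exact. Qed.

Lemma exp_indep_ground I : exp_indep I -> I \subset blowup S E.
Proof. by case/andP. Qed.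

Lemma exp_indep0 : exp_indep set0.
Proof.
rewrite /exp_indep sub0set; apply/forallP => Y; apply/implyP.
by rewrite subset0 => /eqP->; rewrite cards0.
Qed.

Lemma exp_indepS I J : J \subset I -> exp_indep I -> exp_indep J.
Proof.
move=> sJI iI; rewrite /exp_indep (subset_trans sJI (exp_indep_ground iI)).
by apply/forallP => Y; apply/implyP => sYJ; exact: eiP iI (subset_trans sYJ sJI).
Qed.

Lemma exp_dep I e : exp_indep I -> e \in blowup S E -> ~~ exp_indep (e |: I) ->
  exists Y, [/\ Y \subset e |: I, e \in Y & f Y < #|Y|].
Proof.
move=> iI eE; rewrite /exp_indep subUset sub1set eE (exp_indep_ground iI) /=.
case/forallPn => Y; rewrite negb_imply -ltnNge => /andP[sY ltY].
exists Y; split=> //; apply: contraLR ltY => neY; rewrite -leqNgt.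
apply: eiP iI _; apply/subsetP => y yY; have := subsetP sY y yY.
by case/setU1P=> // yE; rewrite -yE yY in neY.
Qed.

Lemma exp_indep_aug I J : exp_indep I -> exp_indep J -> #|I| < #|J| ->
  exists2 e, e \in J :\: I & exp_indep (e |: I).
Proof.
move=> iI iJ ltIJ; apply/exists_inP; apply: contraLR ltIJ => /exists_inPn noe.
pose P := [pred Y : {set T} | (Y \subset I) && (f Y <= #|Y|)].
have P0 : P set0 by rewrite /= sub0set f0.
have [W maxW _] := maxset_exists P0; have /andP[sWI tW] := maxsetp maxW.
have stepW e : e \in J :\: I -> f (e |: W) <= #|W|.
  move=> eJI; have /setDP[eJ neI] := eJI.
  have eE := subsetP (exp_indep_ground iJ) e eJ.
  have [Y [sY eY ltY]] := exp_dep iI eE (noe e eJI).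
  have sY'I : Y :\ e \subset I.
    by apply/subsetP => y /setD1P[ye /(subsetP sY)/setU1P[/eqP|//]]; rewrite (negPf ye).
  have cY' : #|Y| = #|Y :\ e|.+1 by rewrite (cardsD1 e Y) eY.
  have tY' : f (Y :\ e) <= #|Y :\ e|.
    by rewrite -ltnS -cY'; apply: leq_ltn_trans ltY; apply: fS; exact: subD1set.
  have PU : P (W :|: (Y :\ e)).
    rewrite /= subUset sWI sY'I /=.
    rewrite -(leq_add2r #|W :&: (Y :\ e)|) cardsUI.
    have le1 := eiP iI (subset_trans (subsetIl W (Y :\ e)) sWI).
    apply: leq_trans (leq_add tW tY'); apply: leq_trans (fUI _ _).
    by rewrite leq_add2l.
  have sY'W : Y :\ e \subset W by rewrite -(maxsetsup maxW PU (subsetUl _ _)) subsetUr.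
  have neW : e \notin W by apply: contra neI; exact: (subsetP sWI).
  have eU : W :|: Y = e |: W.
    by rewrite -(setD1K eY) setUCA (setUidPl sY'W).
  have eI : W :&: Y = Y :\ e.
    apply/setP => y; rewrite !inE; apply/andP/andP => [[yW yY]|[ye yY]].
      by split=> //; apply: contra neW => /eqP<-.
    by split=> //; apply: (subsetP sY'W); rewrite !inE ye.
  rewrite -(leq_add2r #|Y :\ e|) -{1}eU.
  have le1 := eiP iI sY'I.
  apply: (leq_trans (n := f W + f Y)); last by apply: leq_add => //; rewrite -ltnS -cY'.
  by apply: leq_trans (fUI W Y); rewrite leq_add2l eI.
have allW n (D : {set T}) : #|D| = n -> D \subset J :\: I -> f (D :|: W) <= #|W|.
  elim: n D => [|n IHn] D cD sD; first by rewrite (cards0_eq cD) set0U.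
  have /card_gt0P[d dD] : 0 < #|D| by rewrite cD.
  have cD' : #|D :\ d| = n by move: cD; rewrite (cardsD1 d) dD => -[].
  have le1 := IHn _ cD' (subset_trans (subD1set _ _) sD).
  have le2 := stepW d (subsetP sD d dD).
  rewrite -(leq_add2r #|W|); apply: leq_trans (leq_add le1 le2).
  apply: leq_trans (fUI _ _); apply: leq_add.
    apply: fS; rewrite -{1}(setD1K dD) !subUset sub1set !inE eqxx !orbT /=.
    by rewrite (subset_trans (subsetUl _ W)) ?subsetUl //
      (subset_trans (subsetUr (D :\ d) W)) ?subsetUl.
  apply: leq_trans (eiP iI sWI) _; apply: fS.
  by rewrite subsetI !subsetUr.
have leK : #|(J :&: W) :|: (J :\: I)| <= #|W|.
  apply: leq_trans (allW _ _ erefl (subxx _)).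
  apply: leq_trans (eiP iJ _) _; first by rewrite subUset subsetIl subsetDl.
  by apply: fS; rewrite setUC setUS // subsetIr.
have dK : (J :&: W) :&: (J :\: I) = set0.
  apply/eqP; rewrite -subset0; apply/subsetP => y /setIP[/setIP[_ yW] /setDP[_]].
  by rewrite (subsetP sWI).
rewrite -leqNgt -(cardsID I J) -(cardsID J I) setIC leq_add2l.
apply: (leq_trans (n := #|W :\: J|)); last by rewrite subset_leq_card // setSD.
rewrite -(leq_add2l #|W :&: J|) cardsID (leq_trans _ leK) //.
by rewrite (setIC W) -cardsUI dK cards0 addn0.
Qed.

Definition expansion : matroid T :=
  Matroid exp_indep_ground exp_indep0 exp_indepS exp_indep_aug.
Let N := expansion.

Lemma exp_indep_blowup B : indep M B -> exp_indep (blowup S B).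
Proof.
move=> iB; have sBE := indep_ground iB; have sb := blowupS sBE.
rewrite /exp_indep sb; apply/forallP => Y; apply/implyP => sY.
rewrite rank_indep ?card_trace ?(subset_trans sY) //.
exact: indepS (trace_sub sBE sY) iB.
Qed.

Lemma card_blowup B : B \subset E -> #|blowup S B| = t * #|B|.
Proof.
elim: {B}#|B| {-2}B (erefl #|B|) => [|n IHn] B cB sBE.
  by rewrite (cards0_eq cB) /blowup big_set0 !cards0 muln0.
have /card_gt0P[b bB] : 0 < #|B| by rewrite cB.
have cB' : #|B :\ b| = n by move: cB; rewrite (cardsD1 b) bB => -[].
have sB'E := subset_trans (subD1set B b) sBE.
have bE := subsetP sBE b bB.
have cSb : #|S b| = t by case: hS => _ ->.
have dis : S b :&: blowup S (B :\ b) = set0.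
  apply/eqP; rewrite -subset0; apply/subsetP => e /setIP[eb /blowupP[y /setD1P[yb yB] ey]].
  by rewrite (Sdisj (subsetP sBE y yB) bE ey eb) eqxx in yb.
have -> : blowup S B = S b :|: blowup S (B :\ b) by rewrite /blowup (big_setD1 b bB).
by rewrite cardsU dis cards0 subn0 IHn // cSb (cardsD1 b B) bB mulnDr muln1.
Qed.

Lemma rank_blowup A : A \subset E -> rank N (blowup S A) = t * rank M A.
Proof.
move=> sAE; apply/eqP; rewrite eqn_leq; apply/andP; split.
  have [I [sI iI <-]] := rank_ex N (blowup S A).
  apply: leq_trans (eiP iI (subxx I)) _.
  by rewrite leq_mul2l rankS ?orbT // trace_sub.
have [B [sBA iB <-]] := rank_ex M A.
have sBE := subset_trans sBA sAE.
have iN : indep N (blowup S B) := exp_indep_blowup iB.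
by apply: leq_trans (rank_ge (blowupS sBA) iN); rewrite card_blowup.
Qed.

Lemma expansion_cyclic_flat A : A \in cyclic_flats M -> blowup S A \in cyclic_flats N.
Proof.
case/cyclic_flatP=> sAE fl nc; apply/cyclic_flatP.
split=> [|e /blowupP[x xE ex] neA|e /blowupP[x xA ex]].
- exact: blowupS.
- have nxA : x \notin A by apply: contra neA => xA; apply/blowupP; exists x.
  have [B [sBA iB cB]] := rank_ex M A.
  have [B' [sBB' sB' iB' cB']] := indep_extend (subset_trans sBA (subsetUr [set x] A)) iB.
  have xB' : x \in B'.
    apply/contraT => nxB'; have := fl x xE nxA; rewrite -cB' ltnNge rank_ge //.
    apply/subsetP => y yB'; have /setU1P[yx|//] := subsetP sB' y yB'.
    by rewrite -yx yB' in nxB'.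
  have ixB : indep M (x |: B).
    by apply: indepS iB'; rewrite subUset sub1set xB'.
  have neB : e \notin blowup S B by apply: contra neA; apply/subsetP/blowupS.
  have ieB : indep N (e |: blowup S B).
    apply: exp_indepS (exp_indep_blowup ixB).
    rewrite subUset sub1set (blowupS (subsetUr _ _)) andbT.
    by apply/blowupP; exists x => //; exact: setU11.
  rewrite rank_blowup // -cB -(rank_indep iB) -rank_blowup ?(subset_trans sBA) //.
  apply: leq_trans (rank_ge _ ieB); last by rewrite setUS // blowupS.
  by rewrite cardsU1 neB add1n ltnS rank_le_card.
have xE := subsetP sAE x xA.
apply: (leq_trans (n := rank N (blowup S (A :\ x)))).
  by rewrite !rank_blowup ?(subset_trans (subD1set _ _)) // leq_mul2l nc ?orbT.
apply: rankS; rewrite subsetD1 blowupS ?subD1set //=.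
apply/blowupP => -[y /setD1P[yx yA] ey].
by rewrite (Sdisj (subsetP sAE y yA) xE ey ex) eqxx in yx.
Qed.

Lemma expansion_cyclic_flat_inv F : F \in cyclic_flats N ->
  F = blowup S (trace F) /\ trace F \in cyclic_flats M.
Proof.
case/cyclic_flatP=> sF fl nc.
have full x e e' : x \in E -> e \in S x -> e \in F -> e' \in S x -> e' \in F.
  move=> xE ex eF ex'; apply/contraT => ne'F.
  have eE : e' \in blowup S E by apply/blowupP; exists x.
  have [I [sI iI cI]] := rank_ex N (F :\ e).
  have sIF := subset_trans sI (subD1set F e).
  have neI : e \notin I by move: sI; rewrite subsetD1 => /andP[].
  have dI : ~~ exp_indep (e |: I).
    apply/negP => ieI.
    have le : #|e |: I| <= rank N F.
      by apply: (@rank_ge N) ieI; rewrite subUset sub1set eF.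
    by have := leq_trans le (nc e eF); rewrite -cI cardsU1 neI ltnn.
  have [Y [sY eY ltY]] := exp_dep iI (subsetP sF e eF) dI.
  have [I' [sII' sI' iI' cI']] := indep_extend (subset_trans sIF (subsetUr [set e'] F)) iI.
  have e'I' : e' \in I'.
    apply/contraT => ne'I'; have := fl e' eE ne'F; rewrite -cI' ltnNge rank_ge //.
    apply/subsetP => y yI'; have /setU1P[ye|//] := subsetP sI' y yI'.
    by rewrite -ye yI' in ne'I'.
  have sY'I : Y :\ e \subset I.
    by apply/subsetP => y /setD1P[ye /(subsetP sY)/setU1P[/eqP|//]]; rewrite (negPf ye).
  have sZ : e' |: (Y :\ e) \subset I'.
    by rewrite subUset sub1set e'I' (subset_trans sY'I).
  have ne'Y : e' \notin Y :\ e by apply: contra ne'F => /(subsetP sY'I)/(subsetP sIF).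
  have trZ : trace (e' |: (Y :\ e)) \subset trace Y.
    apply/subsetP => y /traceP[yE [z zy /setU1P[ze|/setD1P[_ zY]]]]; apply/traceP; split=> //.
      by exists e => //; rewrite (Sdisj yE xE zy) // ze.
    by exists z.
  have := eiP iI' sZ; rewrite cardsU1 ne'Y leqNgt => /negP[].
  apply: leq_ltn_trans (leq_trans ltY _); first by rewrite leq_mul2l rankS ?orbT.
  by rewrite (cardsD1 e Y) eY.
have defF : F = blowup S (trace F).
  apply/eqP; rewrite eqEsubset sub_blowup_trace //=.
  apply/subsetP => e' /blowupP[x /traceP[xE [e ex eF]] ex']; exact: full ex eF ex'.
have sAE := traceE F; split=> //; set A := trace F in defF sAE *.
apply/cyclic_flatP; split=> // x xE => [nxA|].
  rewrite ltnNge; apply/negP => le.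
  have nxF : x \notin F.
    by apply: contra nxA => xF; apply/traceP; split=> //; exists x => //; exact: Sid.
  have xN : x \in blowup S E by apply/blowupP; exists x => //; exact: Sid.
  have := fl x xN nxF; rewrite ltnNge => /negP[].
  apply: (leq_trans (n := rank N (blowup S (x |: A)))).
    apply: rankS; rewrite subUset sub1set; apply/andP; split.
      by apply/blowupP; exists x; rewrite ?setU11 // Sid.
    by rewrite {1}defF blowupS // subsetUr.
  by rewrite defF !rank_blowup // ?subUset ?sub1set ?xE // leq_mul2l le orbT.
move: xE => xA; have xE := subsetP sAE x xA; have Sx := Sid xE.
have cSx : #|S x| = t by case: hS => _ ->.
have xF : x \in F by rewrite defF; apply/blowupP; exists x.
rewrite leqNgt; apply/negP => lt; have := nc x xF; rewrite leqNgt => /negP[].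
have sF' : F :\ x \subset blowup S (A :\ x) :|: (S x :\ x).
  apply/subsetP => e /setD1P[ex]; rewrite defF => /blowupP[y yA ey].
  apply/setUP; have [yx|nyx] := eqVneq y x.
    by right; rewrite !inE ex -yx.
  by left; apply/blowupP; exists y => //; apply/setD1P.
apply: leq_ltn_trans (rankS N sF') _.
have le := leq_trans (leq_addr _ _) (rank_submod N (blowup S (A :\ x)) (S x :\ x)).
apply: leq_ltn_trans le _.
apply: (leq_ltn_trans (n := t * rank M (A :\ x) + #|S x :\ x|)).
  by rewrite rank_blowup ?(subset_trans (subD1set _ _)) // leq_add2l rank_le_card.
rewrite defF rank_blowup //; apply: leq_trans (_ : t * (rank M (A :\ x)).+1 <= _).
  by rewrite mulnS addnC ltn_add2r; move: cSx; rewrite (cardsD1 x) Sx => <-.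
by rewrite leq_mul2l lt orbT.
Qed.

Lemma expansionP : is_expansion M t S expansion.
Proof.
split=> //; last by move=> A /cyclic_flatP[sA _ _]; exact: rank_blowup.
apply/setP => F; apply/idP/imsetP => [/expansion_cyclic_flat_inv[defF ZA]|[A ZA ->]].
  by exists (trace F).
exact: expansion_cyclic_flat.
Qed.

End Expansion.

End Matroids.

(* Main.v *)
(** Every rank is [min (r F + #|X - F|)] over cyclic flats [F], so in [N]
    [r Y = min (t * r A + #|Y - S_A|)] over the cyclic flats [A] of [M].  Blowing
    up a [k]-separation of [M] gives a separation of [N] of the required order.
    Conversely, let [A] and [B] attain the ranks of [Y] and of its complement [W].
    Any [X] with [A - B <= X <= E - (B - A)] has
    [lambda X <= c := r A + r B + #|E - A - B| - r M].  Since [#|E| >= 2k], either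
    some such [X] and its complement both have at least [k - 1] elements, so that
    [c >= k - 1] and [lambda Y >= t * (k - 1)]; or [X = E - (B - A)] has fewer
    than [k - 1] elements, so that [c >= #|X|] and [lambda Y >= #|Y|]; or
    symmetrically [lambda Y >= #|W|]. *)
Require Import Defs.
From mathcomp Require Import all_boot zify.

Set Implicit Arguments.
Unset Strict Implicit.
Unset Printing Implicit Defensive.

Lemma subset_interpolate_card (T : finType) (P Q : {set T}) (s : nat) :
  P \subset Q -> #|P| <= s <= #|Q| ->
  exists X : {set T}, [/\ P \subset X, X \subset Q & #|X| = s].
Proof.
move=> sPQ /andP[]; elim: s => [|s IHs].
  by rewrite leqn0 => /eqP P0 _; exists P.
rewrite leq_eqVlt => /predU1P[<- _|leP ltQ]; first by exists P.
have [X [sPX sXQ cX]] := IHs leP (ltnW ltQ).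
have /card_gt0P[e /setDP[eQ neX]] : 0 < #|Q :\: X|.
  by move: ltQ; rewrite -(cardsID X Q) (setIidPr sXQ) cX; lia.
exists (e |: X); split; first exact: subset_trans sPX (subsetUr _ _).
  by rewrite subUset sub1set eQ.
by rewrite cardsU1 neX cX.
Qed.

(** * Rank as a minimum over cyclic flats, and connectivity of the base matroid *)

Section CyclicFlatRank.
Variables (T : finType) (M : matroid T).
Implicit Types (X F A B : {set T}).

Lemma tutte_connectivityP (k : nat) :
  tutte_connectivity M = Some k <->
  has_separation M k /\ (forall j, has_separation M j -> k <= j).
Proof.
rewrite /tutte_connectivity; case: some_separationP => [ex_k | nex].
  case: ex_minnP => m sepm minm; split=> [[<-] // | [sepk mink]].
  by congr Some; apply/eqP; rewrite eqn_leq minm // mink.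
by split=> // -[sepk _]; case: nex; exists k.
Qed.

Lemma rank_le_card_setD X F : rank M X <= rank M F + #|X :\: F|.
Proof.
have [I [sIX iI <-]] := rank_ex M X; rewrite -(cardsID F I) leq_add //.
  by rewrite rank_ge ?subsetIr // (indepS (subsetIl _ _) iI).
exact: subset_leq_card (setSD _ sIX).
Qed.

(* Among the sets attaining the bound, one of least rank and, subject to that,
   of greatest size is a flat without coloops. *)
Lemma rank_attained_cyclic_flat X : X \subset ground M ->
  exists2 F, F \in cyclic_flats M & rank M X = rank M F + #|X :\: F|.
Proof.
move=> sXE.
pose P F := (F \subset ground M) && (rank M F + #|X :\: F| <= rank M X).
have PX : P X by rewrite /P sXE setDv cards0 addn0 leqnn.
(* The weight [#|T|.+1] exceeds every complement size, so this minimum is lexicographic: rank first,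
   then complement. *)
case: (arg_minnP (fun F => rank M F * #|T|.+1 + #|~: F|) PX) => F /andP[sF leF] minF.
exists F; last by apply/eqP; rewrite eqn_leq leF rank_le_card_setD.
apply/cyclic_flatP; split=> // e eF => [neF|]; rewrite leqNgt; apply/negP => lt.
  have le1 : #|X :\: (e |: F)| <= #|X :\: F| by rewrite subset_leq_card // setDS // subsetUr.
  have PeF : P (e |: F) by rewrite /P subUset sub1set eF sF /=; lia.
  have := minF _ PeF.
  have := cardsC F; have := cardsC (e |: F); rewrite cardsU1 neF.
  by have := leq_mul lt (leqnn #|T|.+1); rewrite !mulSn; lia.
have le1 : #|X :\: (F :\ e)| <= #|X :\: F|.+1.
  rewrite -add1n -(cards1 e); apply: leq_trans (leq_card_setU _ _).
  by apply: subset_leq_card; apply/subsetP => x; rewrite !inE; case: eqP.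
have PF : P (F :\ e) by rewrite /P (subset_trans (subD1set _ _)) //=; lia.
have := minF _ PF.
have := cardsC (F :\ e).
by have := leq_mul lt (leqnn #|T|.+1); rewrite mulSn; lia.
Qed.

(** The leftovers [X :\: A] and [ground M :\: X :\: B] are disjoint, and the two inclusions keep
    both outside [A :|: B]. *)
Lemma rank_split_le A B X : X \subset ground M ->
  A :\: B \subset X -> X \subset ground M :\: (B :\: A) ->
  rank M X + rank M (ground M :\: X)
    <= rank M A + rank M B + #|ground M :\: (A :|: B)|.
Proof.
move=> sXE sAX sXB.
have := rank_le_card_setD X A; have := rank_le_card_setD (ground M :\: X) B.
suff : #|X :\: A| + #|ground M :\: X :\: B| <= #|ground M :\: (A :|: B)| by lia.
have d0 : (X :\: A) :&: (ground M :\: X :\: B) = set0.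
  by apply/setP => x; rewrite !inE; case: (x \in X); rewrite /= ?andbF.
rewrite -cardsUI d0 cards0 addn0; apply: subset_leq_card; apply/subsetP => x.
have := subsetP sXE x; have := subsetP sAX x; have := subsetP sXB x; rewrite !inE.
by case: (x \in X); case: (x \in A); case: (x \in B); case: (x \in ground M) => //= h1 h2 h3;
  rewrite ?(h1 isT) ?(h2 isT) ?(h3 isT).
Qed.

(** The hypothesis on [lambda] encodes that [M] has no separation of order at most [m]. *)
Lemma rank_split_connected (m : nat) A B :
  let c := rank M A + rank M B + #|ground M :\: (A :|: B)| in
  A \subset ground M -> B \subset ground M -> m.*2 <= #|ground M| ->
  (forall X, X \subset ground M ->
     minn m (minn #|X| #|ground M :\: X|) <= lambda M X) ->
  [\/ rank M (ground M) + m <= c,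
      rank M (ground M) + #|ground M :\: (B :\: A)| <= c
    | rank M (ground M) + #|ground M :\: (A :\: B)| <= c].
Proof.
move=> c sA sB cE conn; set E := ground M in sA sB cE conn *.
have cardED X : X \subset E -> #|X| + #|E :\: X| = #|E|.
  by move=> sX; rewrite -(cardsID X E) (setIidPr sX).
have sPQ : A :\: B \subset E :\: (B :\: A).
  apply/subsetP => x; rewrite !inE => /andP[nB xA].
  by rewrite xA (negPf nB) (subsetP sA).
have bound s : #|A :\: B| <= s <= #|E :\: (B :\: A)| ->
    rank M E + minn m (minn s (#|E| - s)) <= c.
  case/(subset_interpolate_card sPQ) => X [sPX sXQ cX].
  have sX := subset_trans sXQ (subsetDl _ _).
  apply: leq_trans (rank_split_le sX sPX sXQ).
  rewrite -leq_subRL ?rank_ground_le // -cX -(cardED X sX) addKn.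
  exact: conn.
have cAB := cardED _ (subset_trans (subsetDl A B) sA).
have cBA := cardED _ (subset_trans (subsetDl B A) sB).
have cPQ := subset_leq_card sPQ.
clear conn cardED sPQ sA sB; clearbody c.
set a := #|A :\: B| in bound cAB cPQ *; set b := #|B :\: A| in bound cBA cPQ *.
set q := #|E :\: (B :\: A)| in bound cBA cPQ *.
(* The size [s] of [X] is the top value [q] if even that is below [m], the bottom value [a] if its
   complement is below [m], and otherwise [maxn a m], which leaves at least [m] elements on both
   sides. *)
have [ltq|geq] := ltnP q m.
  by apply: Or32; have := bound q; lia.
have [ltp|gep] := ltnP #|E :\: (A :\: B)| m.
  by apply: Or33; have := bound a; lia.
by apply: Or31; have := bound (maxn a m); lia.
Qed.

End CyclicFlatRank.

(** * Rank and connectivity function of the expansion *)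

Section ExpansionRank.
Variables (T : finType) (M N : matroid T) (t : nat) (S : T -> {set T}).
Hypotheses (hS : expansion_family M t S) (hN : is_expansion M t S N).
Implicit Types (X Y A B W : {set T}).
Local Notation E := (ground M).

Lemma blowupD X A : X \subset E -> A \subset E ->
  blowup S (X :\: A) = blowup S X :\: blowup S A.
Proof.
move=> sX sA; apply/setP => e; apply/blowupP/setDP => [[x /setDP[xX nxA] ex]|].
  split; first by apply/blowupP; exists x.
  apply/blowupP => -[y yA ey]; case: hS => _ _ dis.
  have nxy : x != y by apply: contraNneq nxA => ->.
  have := dis _ _ (subsetP sX x xX) (subsetP sA y yA) nxy.
  by move/disjointFr/(_ ex); rewrite ey.
case=> /blowupP[x xX ex] ne; exists x => //; apply/setDP; split=> //.
by apply: contra ne => xA; apply/blowupP; exists x.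
Qed.

Lemma expansion_rank_le Y A : A \in cyclic_flats M ->
  rank N Y <= t * rank M A + #|Y :\: blowup S A|.
Proof.
by case: hN => _ _ rk ZA; rewrite -rk // rank_le_card_setD.
Qed.

Lemma expansion_rank_attained Y : Y \subset ground N ->
  exists2 A, A \in cyclic_flats M & rank N Y = t * rank M A + #|Y :\: blowup S A|.
Proof.
case: hN => _ cf rk /rank_attained_cyclic_flat[F].
by rewrite cf => /imsetP[A ZA ->] ->; exists A; rewrite // rk.
Qed.

(** Both ranks are minima over the cyclic flats [A] of [M], and each term for [N] is [t] times the
    term for [M]. *)
Lemma expansion_rank_blowup X : X \subset E -> rank N (blowup S X) = t * rank M X.
Proof.
move=> sX; apply/eqP; rewrite eqn_leq; apply/andP; split.
  have [A ZA ->] := rank_attained_cyclic_flat sX.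
  have [sA _ _] := cyclic_flatP _ _ ZA.
  rewrite mulnDr -(card_blowup hS) ?(subset_trans (subsetDl _ _)) // blowupD //.
  exact: expansion_rank_le.
have sN : blowup S X \subset ground N by case: hN => -> _ _; exact: blowupS.
have [A ZA ->] := expansion_rank_attained sN.
have [sA _ _] := cyclic_flatP _ _ ZA.
rewrite -blowupD // (card_blowup hS) ?(subset_trans (subsetDl _ _)) // -mulnDr.
by rewrite leq_mul2l rank_le_card_setD orbT.
Qed.

Lemma expansion_lambda_blowup X : X \subset E ->
  lambda N (blowup S X) = t * lambda M X.
Proof.
move=> sX; have [gN _ _] := hN.
rewrite /lambda gN -blowupD // !expansion_rank_blowup ?subsetDl //.
by rewrite mulnBr mulnDr.
Qed.

(** Each element over [E :\: (A :|: B)] lies in [Y] or [W], hence in a set on the right. The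
    elements of [Y] over [B :\: A] are further members of [Y :\: blowup S A]; this surplus lifts the
    bound to [#|Y|] in the unbalanced case. *)
Lemma expansion_card_setD Y W A B : A \subset E -> B \subset E ->
  Y :|: W = blowup S E ->
  t * #|E :\: (A :|: B)| + #|Y :&: blowup S (B :\: A)|
    <= #|Y :\: blowup S A| + #|W :\: blowup S B|.
Proof.
move=> sA sB YW.
have sAB : A :|: B \subset E by rewrite subUset sA.
rewrite -(card_blowup hS) ?subsetDl //.
set C := blowup S (E :\: (A :|: B)); set D := blowup S (B :\: A).
have CN : C \subset Y :|: W by rewrite YW blowupS // subsetDl.
have CA : C \subset ~: blowup S A.
  rewrite /C blowupD //; apply/subsetP => e /setDP[_]; rewrite inE.
  by apply: contra; apply: subsetP; exact: blowupS (subsetUl _ _).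
have CB : C \subset ~: blowup S B.
  rewrite /C blowupD //; apply/subsetP => e /setDP[_]; rewrite inE.
  by apply: contra; apply: subsetP; exact: blowupS (subsetUr _ _).
have DA : D \subset ~: blowup S A by rewrite /D blowupD // setDE subsetIr.
have DB : D \subset blowup S B by rewrite blowupS // subsetDl.
have -> : #|C| = #|Y :&: C| + #|C :\: Y| by rewrite setIC cardsID.
rewrite addnAC leq_add //.
  have d0 : (Y :&: C) :&: (Y :&: D) = set0.
    apply/setP => e; rewrite !inE; apply/negP => /andP[/andP[_ eC] /andP[_ eD]].
    by have := subsetP CB e eC; rewrite inE (subsetP DB).
  rewrite -cardsUI d0 cards0 addn0; apply: subset_leq_card.
  by rewrite -setIUr setDE setIS // subUset CA.
apply: subset_leq_card; apply/subsetP => e /setDP[eC neY].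
have := subsetP CN e eC; have := subsetP CB e eC.
by rewrite !inE (negPf neY) /= => -> ->.
Qed.

(** The part of [Y] outside [blowup S B] lies over [E :\: B]. *)
Lemma card_le_blowup_setI Y B : B \subset E -> Y \subset blowup S E ->
  #|Y| <= t * #|E :\: B| + #|Y :&: blowup S B|.
Proof.
move=> sB sY; rewrite -(card_blowup hS) ?subsetDl // addnC -(cardsID (blowup S B) Y).
by rewrite leq_add2l subset_leq_card // blowupD // setSD.
Qed.

Lemma expansion_lambda_ge (m : nat) Y : m.*2 <= #|E| ->
  (forall X, X \subset E -> minn m (minn #|X| #|E :\: X|) <= lambda M X) ->
  Y \subset ground N ->
  minn (t * m) (minn #|Y| #|ground N :\: Y|) <= lambda N Y.
Proof.
move=> cE conn sY; have [gN _ _] := hN; set W := ground N :\: Y.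
have sW : W \subset ground N := subsetDl _ _.
have YW : Y :|: W = blowup S E by rewrite -gN -{1}(setIidPr sY) setID.
have [A ZA rY] := expansion_rank_attained sY.
have [B ZB rW] := expansion_rank_attained sW.
have [sA _ _] := cyclic_flatP _ _ ZA; have [sB _ _] := cyclic_flatP _ _ ZB.
rewrite /lambda -/W rY rW gN expansion_rank_blowup //.
have cntY := expansion_card_setD sA sB YW.
have WY : W :|: Y = blowup S E by rewrite setUC.
have cntW := expansion_card_setD sB sA WY.
rewrite [B :|: A]setUC in cntW.
have sBA : B :\: A \subset E := subset_trans (subsetDl _ _) sB.
have sAB : A :\: B \subset E := subset_trans (subsetDl _ _) sA.
have sY' : Y \subset blowup S E by rewrite -gN.
have sW' : W \subset blowup S E by rewrite -gN.
have leY := card_le_blowup_setI sBA sY'.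
have leW := card_le_blowup_setI sAB sW'.
rewrite !geq_min; apply/or3P.
(* Scaled by [t], the first case gives [t * m]; in the others the surplus in [cntY] or [cntW]
   completes the bound to [#|Y|] or [#|W|]. *)
case: (rank_split_connected sA sB cE conn) => /(leq_mul (leqnn t)); rewrite !mulnDr => le.
- apply: Or31; move: le cntY; clear; lia.
- apply: Or32; move: le cntY leY; clear; lia.
- apply: Or33; move: le cntW leW; clear; lia.
Qed.

End ExpansionRank.

(** * Tutte connectivity of the expansion *)

Theorem theorem4p1 (T : finType) (M N : matroid T) (t : nat)
    (S : T -> {set T}) (k : nat)
    (hS : expansion_family M t S) (hN : is_expansion M t S N)
    (hk : tutte_connectivity M = Some k) :
  tutte_connectivity N = Some (t * (k - 1) + 1).
Proof.
have /tutte_connectivityP[/existsP[X /and4P[sX kX kX' lamX]] mink] := hk.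
have [gN _ _] := hN.
have cE : #|ground M| = #|X| + #|ground M :\: X| by rewrite -(cardsID X) (setIidPr sX).
have t_gt0 : 0 < t.
  have /card_gt0P[x xX] : 0 < #|X| by lia.
  case: hS => Sid cS _; have xE := subsetP sX x xX.
  by rewrite -(cS x xE); apply/card_gt0P; exists x; exact: Sid.
apply/tutte_connectivityP; split.
  (* Both sides have at least [t * k] elements, which suffices because [t] is positive. *)
  apply/existsP; exists (blowup S X); apply/and4P; split.
  - by rewrite gN blowupS.
  - by rewrite (card_blowup hS) //; nia.
  - by rewrite gN -(blowupD hS) // (card_blowup hS) ?subsetDl //; nia.
  - rewrite (expansion_lambda_blowup hS hN) //.
    have : lambda M X <= k - 1 by lia.
    by move/(leq_mul (leqnn t)); lia.
move=> j /existsP[Y /and4P[sY jY jY' lamY]]; rewrite leqNgt; apply/negP => ltj.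
have cE2 : (k - 1).*2 <= #|ground M| by lia.
(* A failure would make [Z] an [i]-separation with [i <= k - 1], against the minimality of [k]. *)
have conn (Z : {set T}) : Z \subset ground M ->
    minn (k - 1) (minn #|Z| #|ground M :\: Z|) <= lambda M Z.
  move=> sZ; rewrite leqNgt; apply/negP; set i := minn _ _ => lti.
  have := mink i; have -> : has_separation M i.
    by apply/existsP; exists Z; rewrite /separation sZ lti andbT; lia.
  by move/(_ isT); lia.
(* As [j <= t * (k - 1)], all three terms of the minimum are at least [j], while
   [lambda N Y < j]. *)
by have := expansion_lambda_ge hS hN cE2 conn sY; lia.
Qed.
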